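(* Let $U$ be a countably infinite set and $\mathrm{G}$ a subgroup of $\mathfrak{S}(U)$. Then the cardinality of $\overline{\mathrm{G}}[U]$ is either $1$ or $2^{\aleph_0}$.
   Context: $\overline{\mathrm{G}}$ is the closure of $\mathrm{G}$ in $U^U$ for the function topology: the set of maps $f:U\to U$ such that for every finite $E\subseteq U$ some $g\in\mathrm{G}$ agrees with $f$ on $E$. $\overline{\mathrm{G}}[U]=\{f[U]\mid f\in\overline{\mathrm{G}}\}$ is the set of copies for $\mathrm{G}$. *)

(* Defs.v *)
From mathcomp Require Import all_boot.
From mathcomp Require Import boolp classical_sets functions cardinality.

Set Implicit Arguments.
Unset Strict Implicit.
Unset Printing Implicit Defensive.

Local Open Scope classical_set_scope.

Section Copies.
Variable U : Type.
Implicit Type G : set (U -> U).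

(* G is a subgroup of the symmetric group of U, presented as a set of maps. *)
Definition is_perm_group G : Prop :=
  [/\ forall f, G f -> bijective f,
      G id,
      forall f g, G f -> G g -> G (f \o g)
    & forall f g, G f -> cancel f g -> cancel g f -> G g].

(* Closure for the topology of pointwise convergence on U -> U, with U discrete. *)
Definition fun_closure G : set (U -> U) :=
  [set f : U -> U | forall E : set U, finite_set E ->
             exists2 g, G g & forall x, E x -> f x = g x].

Definition copies G : set (set U) := [set range f | f in fun_closure G].

End Copies.

(* Main.v *)
Require Import Defs.
From mathcomp Require Import all_boot.
From mathcomp Require Import boolp classical_sets functions cardinality.

Local Open Scope classical_set_scope.
Local Open Scope card_scope.

(* The closure M of G is a monoid of injections.  If every f in M is onto, U is
   the only copy.  Otherwise, composing a non-surjective f in M with the inverse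
   of an element of G that agrees with f on a finite set E yields a
   non-surjective element of M that fixes E pointwise.  Choose such elements
   k_0, k_1, ... fixing larger and larger finite sets E_n that exhaust U, with
   a point w_n of E_{n+1} outside the range of k_n.  For a set b of natural
   numbers the infinite composition of the k_n, n in b, converges in M.  If b
   and c first differ at n, with n in c only, and F is the common finite
   composition below n, then F w_n is in the copy of b but not in that of c. *)

Section Closure.
Context {U : Type} {G : set (U -> U)} (hG : is_perm_group G).

Lemma fun_closure_sub : G `<=` fun_closure G.
Proof. by move=> g Gg E _; exists g. Qed.

Lemma fun_closure_comp f g :
  fun_closure G f -> fun_closure G g -> fun_closure G (f \o g).
Proof.
have [_ _ Gcomp _] := hG.
move=> clf clg E finE; have [b Gb gb] := clg E finE.
have [a Ga fa] := clf (g @` E) (finite_image g finE).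
exists (a \o b); first exact: Gcomp.
by move=> x Ex /=; rewrite -gb// fa//; exists x.
Qed.

(** Agreement with a bijection on the two points at hand suffices. *)
Lemma fun_closure_inj f : fun_closure G f -> injective f.
Proof.
have [Gbij _ _ _] := hG.
move=> clf x y fxy; have [g Gg fg] := clf [set x; y] (finite_set2 x y).
apply: (bij_inj (Gbij g Gg)).
by rewrite -fg; [rewrite -fg//; right | left].
Qed.

(** Serves [limit_comp], whose finite approximations lie in the closure and need not lie in [G]. *)
Lemma fun_closure_closed f :
  (forall E : set U, finite_set E ->
     exists2 g, fun_closure G g & forall x, E x -> f x = g x) ->
  fun_closure G f.
Proof.
move=> appf E finE; have [g clg fg] := appf E finE.
have [h Gh gh] := clg E finE.
by exists h => // x Ex; rewrite fg// gh.
Qed.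

Lemma fun_closure_fixing (f : U -> U) (x : U) (E : set U) :
    fun_closure G f -> ~ range f x -> finite_set E ->
  exists p : (U -> U) * U,
    [/\ fun_closure G p.1, forall y, E y -> p.1 y = y & ~ range p.1 p.2].
Proof.
have [Gbij _ _ Ginv] := hG.
move=> clf fx finE; have [g Gg fg] := clf E finE.
have [h gK hK] := Gbij g Gg.
exists (h \o f, h x); split=> /=.
- by apply: fun_closure_comp => //; apply/fun_closure_sub/(Ginv g).
- by move=> y Ey; rewrite fg.
- by case=> y _ /(can_inj hK) fyx; apply: fx; exists y.
Qed.

End Closure.

Section Branches.
Context {U : Type} {G : set (U -> U)} (hG : is_perm_group G).
Context {rk : U -> nat}.
Context {K : nat -> U -> U} {W : nat -> U}.
Hypothesis clK : forall n, fun_closure G (K n).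
Hypothesis fixK : forall n x, rk x < n -> K n x = x.
Hypothesis missK : forall n, ~ range (K n) (W n).

(** The set E_n is the set of points of rank below [level n], with k_n = [K (level n)] and w_n =
    [W (level n)]. The successor puts w_n into E_{n+1}, so that all later factors fix it. *)
Fixpoint level n := if n is n'.+1 then (rk (W (level n'))).+1 else 0.

(** A point of smaller rank would be fixed by [K (level n)], hence in its range. *)
Lemma leq_level n : level n <= rk (W (level n)).
Proof.
rewrite leqNgt; apply/negP => /fixK fixW.
by apply: (missK (level n)); exists (W (level n)).
Qed.

Lemma leq_id_level n : n <= level n.
Proof. by elim: n => //= n IH; rewrite ltnS (leq_trans IH)// leq_level. Qed.

Lemma level_mono m n : m <= n -> level m <= level n.
Proof.
elim: n => [|n IH]; first by case: m.
rewrite leq_eqVlt => /predU1P[->//|/IH mn].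
by rewrite (leq_trans mn)//= leqW// leq_level.
Qed.

(** New factors act first: values stabilize at points that the later factors fix, and the ranges
    decrease with [n]. *)
Fixpoint partial_comp (b : set nat) n : U -> U :=
  if n is n'.+1 then
    partial_comp b n' \o (if n' \in b then K (level n') else id)
  else id.

Definition limit_comp (b : set nat) (x : U) : U := partial_comp b (rk x).+1 x.

Lemma partial_comp_closure b n : fun_closure G (partial_comp b n).
Proof.
have [_ Gid _ _] := hG; have clid := fun_closure_sub _ Gid.
by elim: n => //= n IH; apply: (fun_closure_comp hG) => //; case: ifP.
Qed.

Lemma partial_comp_stable b m n x :
  rk x < level m -> m <= n -> partial_comp b n x = partial_comp b m x.
Proof.
move=> xm; elim: n => [|n IH]; first by case: m xm.
rewrite leq_eqVlt => /predU1P[->//|mn] /=.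
case: ifP => _; rewrite ?fixK; try exact: IH.
by apply: (leq_trans xm); exact: level_mono.
Qed.

Lemma limit_compE b n x : rk x < level n -> limit_comp b x = partial_comp b n x.
Proof.
move=> xn; have [le|/ltnW le] := leqP n (rk x).+1.
  exact: partial_comp_stable.
by rewrite (@partial_comp_stable _ (rk x).+1 n)// leq_id_level.
Qed.

Lemma limit_comp_closure b : fun_closure G (limit_comp b).
Proof.
apply: fun_closure_closed => E finE.
have [n rkE] : exists n, forall x, E x -> rk x < n.
  have [s Es] := (finite_seqP _).1 (finite_image rk finE).
  exists (\max_(i <- s) i).+1 => x Ex; rewrite ltnS.
  suff xs : rk x \in s by rewrite (big_rem _ xs) leq_maxl.
  by have : (rk @` E) (rk x) by [exists x]; rewrite Es.
exists (partial_comp b n); first exact: partial_comp_closure.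
by move=> x /rkE xn; apply/limit_compE/(leq_trans xn)/leq_id_level.
Qed.

Lemma range_partial_comp b m n :
  m <= n -> range (partial_comp b n) `<=` range (partial_comp b m).
Proof.
elim: n => [|n IH]; first by rewrite leqn0 => /eqP->.
rewrite leq_eqVlt => /predU1P[->//|/IH mn] _ [x _ <-].
by apply: mn; exists ((if n \in b then K (level n) else id) x).
Qed.

Lemma range_limit_comp b n : range (limit_comp b) `<=` range (partial_comp b n).
Proof.
(* Either the defining stage of the value at [x] is at least [n], and ranges decrease, or the value
   at [x] is already settled at stage [n]. *)
move=> _ [x _ <-]; have [le|/ltnW le] := leqP n (rk x).+1.
  by apply: (range_partial_comp _ _ _ le); exists x.
exists x => //; rewrite (@limit_compE _ n)//.
by rewrite (leq_trans _ (leq_id_level n)).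
Qed.

Lemma range_limit_comp_split (b c : set nat) n :
    (forall m, m < n -> (m \in b) = (m \in c)) ->
    n \notin b -> n \in c ->
  range (limit_comp b) <> range (limit_comp c).
Proof.
move=> bc nb nc eq_range.
have eqF : forall m, m <= n -> partial_comp b m = partial_comp c m.
  by elim=> //= m IH mn; rewrite IH ?(ltnW mn)// bc.
(* The limit for [b] at [W (level n)] is settled at stage [n.+1], where the newest factor is the
   identity. *)
have : range (limit_comp b) (partial_comp b n (W (level n))).
  by exists (W (level n)) => //; rewrite (@limit_compE _ n.+1)//= (negbTE nb).
(* For [c] the newest factor is [K (level n)]; cancelling the injective common part would put
   [W (level n)] in its range. *)
rewrite eq_range => /(range_limit_comp _ n.+1)[x _] /=.
rewrite nc -eqF// => /(fun_closure_inj hG _ (partial_comp_closure b n)) Kx.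
by apply: (missK (level n)); exists x.
Qed.

Lemma range_limit_comp_inj : injective (fun b => range (limit_comp b)).
Proof.
move=> b c eq_range; apply/seteqP; apply: contrapT => neq.
have ex_nbc : exists n, (n \in b) != (n \in c).
  apply: contrapT => /forallNP eqbc; apply: neq.
  have {}eqbc n : (n \in b) = (n \in c) by apply/eqP/negPn/negP/eqbc.
  by split=> n /mem_set nbc; apply: set_mem; rewrite ?eqbc // -eqbc.
have [n nbc n_min] :=
  @ex_minnP (fun n => (n \in b) != (n \in c)) ex_nbc.
have eqbc m : m < n -> (m \in b) = (m \in c).
  by move=> mn; apply/eqP; apply: contraTT mn => /n_min; rewrite -leqNgt.
case: (boolP (n \in c)) nbc => nc nb.
  apply: (range_limit_comp_split b c n) => //.
  by move: nb; case: (n \in b).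
apply: (range_limit_comp_split c b n) => //.
- by move=> m /eqbc.
- by move: nb; case: (n \in b).
Qed.

Lemma card_ge_copies : [set: set nat] #<= copies G.
Proof.
have := @inj_card_eq _ _ setT _ (in2W range_limit_comp_inj).
move=> /card_eqPle[_ le]; apply: (card_le_trans le).
apply: subset_card_le => _ [b _ <-].
by exists (limit_comp b) => //; exact: limit_comp_closure.
Qed.

End Branches.

Theorem theorem5p5 (U : Type) (G : set (U -> U))
    (hU : [set: U] #= [set: nat]) (hG : is_perm_group G) :
  (copies G #= [set: unit]) \/ (copies G #= [set: set nat]).
Proof.
have [rk] := pcard_leTP (proj1 ((card_eqPle _ _).1 hU)).
have rk_inj : injective rk by move=> x y; apply: inj; rewrite inE.
case: (pselect (exists p : (U -> U) * U,
         fun_closure G p.1 /\ ~ range p.1 p.2)) => [[[f x] [/= clf fx]]|onto].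
- right; apply/card_eqPle; split.
    (* Upper bound: images under [rk] inject the subsets of [U] into those of the naturals. *)
    apply: (card_le_trans (card_leT _)).
    have image_rk_inj : injective (fun A : set U => rk @` A).
      move=> A B eqAB; apply/seteqP; split=> y.
        by rewrite -(image_inj rk_inj) eqAB image_inj.
      by rewrite -(image_inj rk_inj) -eqAB image_inj.
    have := @inj_card_eq _ _ setT _ (in2W image_rk_inj).
    by move=> /card_eqPle[_ le]; apply: (card_le_trans le); exact: card_leT.
  have finE n : finite_set [set y | rk y < n].
    apply: (@finite_preimage _ _ `I_n rk); last exact: finite_II.
    by move=> y z _ _; exact: rk_inj.
  have [P HP] := choice (fun n => fun_closure_fixing hG f x _ clf fx (finE n)).
  by apply: (@card_ge_copies _ _ hG rk (fst \o P) (snd \o P)) => n; case: (HP n).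
- left; have -> : copies G = [set setT].
    have [_ Gid _ _] := hG.
    apply/seteqP; split=> [_ [f clf <-]|_ ->].
      apply/seteqP; split=> // x _; apply: contrapT => fx.
      by apply: onto; exists (f, x).
    exists id; first exact: fun_closure_sub.
    by rewrite image_id.
  have -> : [set: unit] = [set tt] by apply/seteqP; split=> [[]|].
  exact: eq_card1.
Qed.
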